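(* Let $G$ be a graph such that for all $S\subseteq V(G)$ $$\frac{3}{2}\,iso(G\setminus S)+\omega(G\setminus S)\le \frac{1}{2}|S|+1.$$ Then $G$ has a connected $\{2,4\}$-factor.
   Context: Graphs are finite, have no loops, but may have multiple edges; degrees count multiplicities. For $S\subseteq V(G)$, $G\setminus S$ is the graph obtained by deleting $S$; $\omega(\cdot)$ is the number of connected components and $iso(\cdot)$ the number of isolated vertices. For a set $A$ of integers, an $A$-factor is a spanning subgraph all of whose vertex degrees lie in $A$. *)

(* Defs.v *)
From mathcomp Require Import all_boot.
Set Implicit Arguments. Unset Strict Implicit. Unset Printing Implicit Defensive.

(* A finite loopless multigraph on vertex type V is given by an edge
   multiplicity function m : V -> V -> nat which is symmetric with m x x = 0. *)
Definition multigraph (V : finType) (m : V -> V -> nat) : Prop :=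
  (forall x y, m x y = m y x) /\ (forall x, m x x = 0).

Definition deg (V : finType) (m : V -> V -> nat) (x : V) : nat :=
  \sum_(y : V) m x y.

Definition adjD (V : finType) (m : V -> V -> nat) (S : {set V}) : rel V :=
  fun x y => [&& x \notin S, y \notin S & 0 < m x y].

Definition omega (V : finType) (m : V -> V -> nat) (S : {set V}) : nat :=
  #|[set [set y in ~: S | connect (adjD m S) x y] | x in ~: S]|.

Definition iso (V : finType) (m : V -> V -> nat) (S : {set V}) : nat :=
  #|[set x in ~: S | [forall y, ~~ adjD m S x y]]|.

Definition spanning_subgraph (V : finType) (m f : V -> V -> nat) : Prop :=
  multigraph f /\ (forall x y, f x y <= m x y).

Definition is_factor (V : finType) (m : V -> V -> nat) (A : seq nat)
  (f : V -> V -> nat) : Prop :=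
  spanning_subgraph m f /\ (forall x, deg f x \in A).

Definition connected_mg (V : finType) (f : V -> V -> nat) : Prop :=
  forall x y, connect (fun a b => 0 < f a b) x y.

(* Main.v *)
Require Import Defs.
From mathcomp Require Import all_boot zify.
Set Implicit Arguments. Unset Strict Implicit. Unset Printing Implicit Defensive.

(** Call a multigraph sparse if every nonempty vertex set Z spans at most
    2(|Z| - 1) edges, and Z tight if equality holds.  It suffices to find a
    sparse subgraph H of G of maximum degree at most 5 in which V is tight: by a
    Henneberg induction, H contains two edge-disjoint connected spanning
    subgraphs T1 and T2, and T1 together with a T-join in T2 for the vertices of
    odd degree in T1 is connected with all degrees even and at most 5.

    The hypothesis implies 2|P| <= e(P) + |S| + 2 for every partition P of V \ S,
    where e(P) counts the edges between different parts.  With S empty this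
    yields a sparse H in which V is tight.  If the maximum degree k + 1 of H
    exceeds 5, local search in the style of Fürer and Raghavachari lowers it: let
    S be a set of vertices of degree at least k that contains all those of
    degree k + 1.  Counting the edges of H at S gives an edge uv of G - S outside
    H whose ends lie in no common tight set avoiding S.  Exchanging uv for an
    edge at a vertex w of S in the smallest tight set around u and v reduces the
    degree of w.  Either w has degree k + 1 and the search has progressed, or all
    such w can be removed from S. *)

Lemma sum_eq1 (V : finType) (x0 : V) : \sum_x (x == x0) = 1.
Proof. by rewrite (bigD1 x0) //= eqxx big1 // => x /negPf->. Qed.

(** * The partition form of the toughness hypothesis *)

Section Partitions.
Variables (V : finType) (m : V -> V -> nat).
Hypothesis mg : multigraph m.

(** A partition of the complement of [S] is encoded by the fibres of a colouring [c]. Each edge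
    between different parts is counted in both directions, so this is twice e(P). *)
Definition cross (T : eqType) (H : V -> V -> nat) (c : V -> T) (S : {set V}) : nat :=
  \sum_x \sum_y [&& x \notin S, y \notin S & c x != c y] * H x y.

Lemma connect_adjD_setD (A X : {set V}) x y :
  X \subset A -> (forall a b, a \in X -> b \notin A -> m a b = 0) -> x \notin A ->
  connect (adjD m (A :\: X)) x y = connect (adjD m A) x y.
Proof.
move=> XA noE xA; apply/idP/idP; last first.
  apply: connect_sub => a b /and3P[aA bA ab]; apply: connect1.
  by rewrite /adjD !inE (negPf aA) (negPf bA) !andbF.
case/connectP=> p; elim: p x xA => [|z p IH] x xA /=.
  by move=> _ ->; rewrite connect0.
case/andP=> /and3P[_ zA xz] pth ye.
have zA' : z \notin A.
  apply/negP => zinA; move: zA; rewrite !inE zinA andbT negbK => zX.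
  by move: xz; rewrite mg.1 (noE _ _ zX xA).
apply: connect_trans (IH z zA' pth ye); apply: connect1.
by rewrite /adjD xA zA'.
Qed.

(** Putting back [X], which has no neighbour outside [A], keeps every old component and adds at
    least the one of [x0]. *)
Lemma omega_setD (A X : {set V}) :
  X \subset A -> X != set0 -> (forall a b, a \in X -> b \notin A -> m a b = 0) ->
  omega m A < omega m (A :\: X).
Proof.
move=> XA /set0Pn[x0 x0X] noE; rewrite /omega.
set C := fun (B : {set V}) x => [set y in ~: B | connect (adjD m B) x y].
have eqC x : x \notin A -> C (A :\: X) x = C A x.
  move=> xA; apply/setP => y; rewrite !inE connect_adjD_setD //.
  case: (boolP (y \in A)) => yA /=; last by rewrite andbF.
  rewrite andbT; apply/negP => /andP[_ /connectP[p]].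
  elim: p x xA => [|z p IH] x xA /=; first by move=> _ e; rewrite -e yA in xA.
  by case/andP=> /and3P[_ zA _]; apply: IH.
have sub : C (A :\: X) x0 |: [set C A x | x in ~: A] \subset
    [set C (A :\: X) x | x in ~: (A :\: X)].
  apply/subsetP => K; rewrite in_setU1 => /predU1P[->|/imsetP[x xA ->]].
    by apply: imset_f; rewrite !inE x0X.
  move: xA; rewrite inE => xA; rewrite -eqC //.
  by apply: imset_f; rewrite !inE (negPf xA) andbF.
apply: leq_trans (subset_leq_card sub); rewrite cardsU1.
suff -> : C (A :\: X) x0 \notin [set C A x | x in ~: A] by [].
apply/imsetP => -[x _ e]; have : x0 \in C (A :\: X) x0 by rewrite !inE x0X connect0.
by rewrite e !inE (subsetP XA).
Qed.

Lemma iso_setD (A X : {set V}) :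
  X \subset A -> (forall a b, a \in X -> b \notin A -> m a b = 0) ->
  iso m A + (#|X| == 1) <= iso m (A :\: X).
Proof.
move=> XA noE; rewrite /iso.
set I := fun B : {set V} => [set x in ~: B | [forall y, ~~ adjD m B x y]].
have sub : I A \subset I (A :\: X).
  apply/subsetP => x; rewrite !inE => /andP[xA /forallP f].
  rewrite (negPf xA) andbF /=; apply/forallP => y; apply: contra (f y).
  case/and3P=> _; rewrite !inE => yA xy; rewrite /adjD xA xy andbT /=.
  apply/negP => yinA; move: yA; rewrite yinA andbT negbK => yX.
  by move: xy; rewrite mg.1 (noE _ _ yX xA).
case: eqP => [/eqP/cards1P[x eX]|_]; last by rewrite addn0 subset_leq_card.
have xA : x \in A by apply: (subsetP XA); rewrite eX inE.
have sub2 : x |: I A \subset I (A :\: X).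
  rewrite subUset sub andbT sub1set !inE eX inE eqxx /=.
  apply/forallP => y; apply/negP => /and3P[_]; rewrite !inE negb_and negbK.
  case/predU1P=> [->|yA]; first by rewrite mg.2.
  by rewrite noE // eX inE.
apply: leq_trans (subset_leq_card sub2); rewrite cardsU1 addnC.
by rewrite !inE xA.
Qed.

(** The rows of vertices in [A :\: S] vanish once [A] is deleted. Lost pairs whose second vertex
    alone lies in [A :\: S] are ignored, hence only an inequality. *)
Lemma cross_setS (T : eqType) (c : V -> T) (S A : {set V}) :
  S \subset A ->
  cross m c A + \sum_(x in A :\: S) \sum_y [&& x \notin S, y \notin S & c x != c y] * m x y
    <= cross m c S.
Proof.
move=> SA; rewrite /cross [X in _ + X]big_mkcond -big_split /=; apply: leq_sum => x _.
rewrite !inE; case: (boolP (x \in A)) => xA /=.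
  rewrite big1 ?add0n; first by case: ifP.
  by move=> y _; rewrite mul0n.
rewrite andbF addn0; apply: leq_sum => y _; rewrite leq_mul2r; apply/orP; right.
have -> /= : x \notin S by apply: contra xA; apply: (subsetP SA).
case: (boolP (y \in A)) => // yA.
by have -> : y \notin S by apply: contra yA; apply: (subsetP SA).
Qed.

(* Deleting an endpoint of a cross edge inside a non-singleton part never loses
   anything, so all remaining cross edges join singletons; among these, isolate
   a vertex of minimum degree and recurse. *)
Lemma tough_partition_aux (T : finType) (c : V -> T) (S : {set V}) :
  exists2 A : {set V}, S \subset A &
    4 * #|c @: ~: S| + 2 * #|A| <= cross m c S + 2 * #|S| + 6 * iso m A + 4 * omega m A.
Proof.
have [n] := ubnP #|~: S|; elim: n S => // n IH S ltn.
(* Common recursion: [N] is deleted for good, while [X], which has edges only to itself, [S] and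
   [N], is deleted for the recursive call and then put back. It returns as at least one new
   component, isolated if [X] is a single vertex. *)
have IHX (X N : {set V}) : X != set0 -> [disjoint X & S] -> [disjoint N & S] ->
    [disjoint X & N] ->
    (forall a b, a \in X -> b \notin S :|: N :|: X -> m a b = 0) ->
    cross m c (S :|: N :|: X) + 6 * #|N| <= cross m c S + 6 * (#|X| == 1) ->
    #|c @: ~: S| <= #|c @: ~: (S :|: N :|: X)| + #|N|.+1 ->
    exists2 A : {set V}, S \subset A &
    4 * #|c @: ~: S| + 2 * #|A| <= cross m c S + 2 * #|S| + 6 * iso m A + 4 * omega m A.
  move=> X0 XS NS XN noE crossle cle.
  have [|B sB leB] := IH (S :|: N :|: X).
    apply: leq_trans (_ : #|~: S| <= _) => //; apply: proper_card.
    rewrite properC; apply/properP; split.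
      by rewrite -setUA subsetUl.
    case/set0Pn: X0 => x xX; exists x; first by rewrite !inE xX orbT.
    by rewrite (disjointFr XS).
  have XB : X \subset B by apply: subset_trans sB; rewrite subsetUr.
  have noE' a b : a \in X -> b \notin B -> m a b = 0.
    by move=> aX bB; apply: noE => //; apply: contra bB; apply: (subsetP sB).
  exists (B :\: X).
    apply/subsetP => x xS; rewrite inE (disjointFl XS xS) /=.
    by apply: (subsetP sB); rewrite !inE xS.
  have := omega_setD XB X0 noE'; have := iso_setD XB noE'.
  have cX : #|B :\: X| + #|X| = #|B| by rewrite -(cardsID X B) (setIidPr XB) addnC.
  have cS : #|S :|: N :|: X| = #|S| + #|N| + #|X|.
    rewrite !cardsU [_ :&: X](_ : _ = set0); last first.
      apply/setP => x; rewrite !inE; case: (boolP (x \in X)) => xX; rewrite ?andbF //.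
      by rewrite (disjointFr XS xX) (disjointFr XN xX).
    rewrite setIC; move: NS; rewrite -setI_eq0 => /eqP ->.
    by rewrite cards0 !subn0.
  lia.
pose two := [pred p : V * V | [&& p.1 \notin S, p.2 \notin S, p.1 != p.2 & c p.1 == c p.2]].
case: (pickP two) => [[a b] /and4P[/= aS bS ab /eqP cab]|inj].
  (* If a cross edge [x z] leaves the part of [a], delete [x]: the cost 2 of a larger [S] is paid by
     the two orientations of [x z], and no part is lost. *)
  case: (pickP [pred p : V * V | [&& p.1 \notin S, p.2 \notin S, c p.1 == c a,
    c p.2 != c a & 0 < m p.1 p.2]]).
    case=> [x z] /and5P[/= xS zS /eqP cx cz xz].
    have [|B sB leB] := IH (x |: S).
      apply: leq_trans (_ : #|~: S| <= _) => //; apply: proper_card.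
      by rewrite properC properUr // sub1set.
    exists B; first by apply: subset_trans sB; apply: subsetUr.
    have -> : c @: (~: S) = c @: (~: (x |: S)).
      apply/eqP; rewrite eqEsubset; apply/andP; split; last first.
        by apply: imsetS; rewrite setCS subsetUr.
      apply/subsetP => t /imsetP[y]; rewrite inE => yS ->.
      have [->|yx] := eqVneq y x; last by apply: imset_f; rewrite !inE negb_or yx.
      (* The part of [x] survives, represented by [b] if [x] is [a], and by [a] otherwise. *)
      have [e|ne] := eqVneq x a.
        by rewrite e cab imset_f // !inE negb_or bS eq_sym ab.
      by rewrite cx imset_f // !inE negb_or aS eq_sym ne.
    have : cross m c (x |: S) + 2 <= cross m c S.
      have zx' : x != z by apply: contraNneq cz => <-; rewrite cx.
      have -> : cross m c (x |: S) + 2 = \sum_y (\sum_w [&& y \notin x |: S, w \notin x |: S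
          & c y != c w] * m y w + (y == x) + (y == z)).
        by rewrite !big_split /= !sum_eq1 -addnA.
      apply: leq_sum => y _; have [->|yx] := eqVneq y x.
        rewrite (negPf zx') addn0 [X in X + _](_ : _ = 0); last first.
          by apply: big1 => w _; rewrite !inE eqxx.
        by rewrite (bigD1 z) //= xS zS cx eq_sym cz /= mul1n addn_gt0 xz.
      rewrite addn0; have [->|yz] := eqVneq y z.
        rewrite addn1 (bigD1 x) //= [X in _ < X](bigD1 x) //= !inE eqxx /= andbF mul0n add0n.
        rewrite xS zS cx cz /= mul1n -[X in X < _]add0n -addSn; apply: leq_add.
          by rewrite mg.1.
        apply: leq_sum => w _; rewrite leq_mul2r; apply/orP; right.
        rewrite !inE; case: (z == x); case: (w == x); case: (z \in S);
          case: (w \in S) => //; case: (c z != c w) => //.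
      rewrite addn0; apply: leq_sum => w _; rewrite leq_mul2r; apply/orP; right.
      by rewrite !inE (negPf yx); case: (w == x) => //=; rewrite ?andbF.
    have : #|x |: S| = #|S|.+1 by rewrite cardsU1 xS.
    lia.
  (* No edge leaves the part of [a], so it is a union of components of G - S; recurse with [N]
     empty. *)
  move=> none; pose X := [set x in ~: S | c x == c a].
  apply: (IHX X set0).
  - by apply/set0Pn; exists a; rewrite !inE aS eqxx.
  - by rewrite -setI_eq0; apply/eqP/setP => x; rewrite !inE; case: (x \in S); rewrite ?andbF.
  - by rewrite -setI_eq0 set0I.
  - by rewrite -setI_eq0 setI0.
  - move=> x z; rewrite !inE orbF negb_or => /andP[xS cx] /andP[zS]; rewrite zS /= => cz.
    by have := none (x, z); rewrite /= xS zS cx cz /= lt0n => /negbFE/eqP.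
  - rewrite cards0 muln0 addn0; apply: leq_trans (leq_addr _ _).
    have SX : S \subset S :|: set0 :|: X by rewrite setU0 subsetUl.
    by have := cross_setS c SX; lia.
  - rewrite cards0 addn1 -[X in _ <= X]add1n.
    apply: leq_trans (_ : #|c a |: c @: ~: (S :|: set0 :|: X)| <= _).
      apply: subset_leq_card; apply/subsetP => t /imsetP[y]; rewrite inE => yS ->.
      rewrite in_setU1; case: eqP => //= /eqP cy; apply: imset_f.
      by rewrite !inE orbF negb_or yS /= (negPf cy).
    by rewrite cardsU1 leq_add2r leq_b1.
have injc x y : x \notin S -> y \notin S -> c x = c y -> x = y.
  move=> xS yS e; have := inj (x, y); rewrite /= xS yS e eqxx andbT /=.
  by move/negbFE/eqP.
case: (pickP (mem (~: S))) => [v0 v0S|none]; last first.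
  exists S => //; rewrite (_ : ~: S = set0); last by apply/setP => x;
    have := none x; rewrite /= => ->; rewrite inE.
  rewrite imset0 cards0; lia.
pose cd x := \sum_y [&& x \notin S, y \notin S & c x != c y] * m x y.
(* All parts are singletons. With r = |N|, each of the r + 1 vertices of [v |: N] has cross degree
   at least that of [v], hence at least r, so isolating [v] destroys at least r (r + 1) ordered
   cross pairs. *)
case: (arg_minnP cd v0S) => v; rewrite /= inE => vS vmin.
pose N := [set y in ~: S | 0 < m v y].
have vN : v \notin N by rewrite !inE mg.2 andbF.
have rcd : #|N| <= cd v.
  rewrite -sum1_card big_mkcond; apply: leq_sum => y _; rewrite !inE vS /=.
  case: ifP => // /andP[yS vy]; rewrite yS /=.
  case: (boolP (c v == c y)) => [/eqP cvy|_]; last by rewrite mul1n.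
  by move: vy; rewrite (injc _ _ vS yS cvy) mg.2.
apply: (IHX [set v] N).
- by apply/set0Pn; exists v; rewrite inE.
- by rewrite disjoints1.
- by rewrite -setI_eq0; apply/eqP/setP => x; rewrite !inE; case: (x \in S); rewrite ?andbF.
- by rewrite disjoints1.
- move=> x y; rewrite !inE !negb_or => /eqP -> /andP[/andP[yS]]; rewrite yS /= -eqn0Ngt.
  by move/eqP.
- rewrite cards1 eqxx.
  have SX : S \subset S :|: N :|: [set v] by rewrite -setUA subsetUl.
  have := cross_setS c SX.
  have -> : (S :|: N :|: [set v]) :\: S = v |: N.
    apply/setP => x; rewrite !inE; have [->|] := eqVneq x v; first by rewrite vS orbT.
    by case: (x \in S) => //=; rewrite orbF.
  have : \sum_(x in v |: N) cd v <= \sum_(x in v |: N) cd x.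
    apply: leq_sum => x; rewrite in_setU1 => /predU1P[-> //|].
    by rewrite inE => /andP[xS _]; apply: vmin.
  rewrite sum_nat_const cardsU1 vN -/cd /= => h1 h2.
  (* (r - 2) (r - 3) >= 0 for every natural number r *)
  have h3 r : r * r + r + 6 >= 6 * r by case: r => [|[|[|r]]] //; nia.
  have h4 : (1 + #|N|) * #|N| <= (1 + #|N|) * cd v by rewrite leq_mul2l rcd orbT.
  have {}h2 := leq_trans (leq_add (leqnn _) (leq_trans h4 h1)) h2.
  have := h3 #|N|; lia.
- apply: leq_trans (_ : #|(c @: (~: (S :|: N :|: [set v]))) :|: (c @: (v |: N))| <= _).
    apply: subset_leq_card; apply/subsetP => t /imsetP[y]; rewrite inE => yS ->.
    rewrite -imsetU; apply: imset_f; rewrite !inE (negPf yS) /=.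
    by case: (y == v); case: (0 < m v y).
  rewrite cardsU; apply: leq_trans (leq_subr _ _) _; rewrite leq_add2l.
  by apply: leq_trans (leq_imset_card _ _) _; rewrite cardsU1 vN.
Qed.

(** This is twice the inequality 2|P| <= e(P) + |S| + 2. The hypothesis applied to [A] cancels the
    term 2|A|. *)
Lemma tough_partition (T : finType) (c : V -> T) (S : {set V}) :
  (forall A : {set V}, 3 * iso m A + 2 * omega m A <= #|A| + 2) ->
  4 * #|c @: ~: S| <= cross m c S + 2 * #|S| + 4.
Proof. by move=> tough; have [A _] := tough_partition_aux c S; have := tough A; lia. Qed.

End Partitions.

(** * Sparse multigraphs and uncrossing of tight sets *)

Section SparseGraphs.
Variable V : finType.
Implicit Types (H K : V -> V -> nat) (A B S X Z : {set V}).

(* Twice the number of edges of [H] inside [Z]. *)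
Definition edges2 H Z : nat := \sum_x \sum_y ((x \in Z) && (y \in Z)) * H x y.

(* By the Nash-Williams arboricity theorem, these are the multigraphs that
   decompose into two forests; see [two_connected_subgraphs]. *)
Definition sparse H : Prop := forall Z, Z != set0 -> edges2 H Z + 4 <= 4 * #|Z|.

Definition tight H Z : bool := edges2 H Z + 4 == 4 * #|Z|.

Definition agree_off X H K : Prop := forall x y, ~~ ((x \in X) && (y \in X)) -> K x y = H x y.

Definition edge (u v x y : V) : nat := ((x == u) && (y == v)) + ((x == v) && (y == u)).

Lemma edge_sym u v x y : edge u v x y = edge u v y x.
Proof. by rewrite /edge addnC; congr (nat_of_bool _ + nat_of_bool _); rewrite andbC. Qed.

Lemma edgexx u v x : u != v -> edge u v x x = 0.
Proof.
by move=> uv; rewrite /edge; have [->|] := eqVneq x u; rewrite ?(negPf uv) ?andbF.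
Qed.

Lemma deg_edge u v x : deg (edge u v) x = (x == u) + (x == v).
Proof.
rewrite /deg /edge big_split /=; congr (_ + _).
  under eq_bigr => y _ do rewrite -mulnb.
  by rewrite -big_distrr /= sum_eq1 muln1.
under eq_bigr => y _ do rewrite -mulnb.
by rewrite -big_distrr /= sum_eq1 muln1.
Qed.

Lemma degD H K x : deg (fun a b => H a b + K a b) x = deg H x + deg K x.
Proof. exact: big_split. Qed.

Lemma edges2D H K Z :
  edges2 (fun a b => H a b + K a b) Z = edges2 H Z + edges2 K Z.
Proof.
rewrite /edges2 -big_split; apply: eq_bigr => x _; rewrite -big_split.
by apply: eq_bigr => y _; rewrite mulnDr.
Qed.

Lemma sum_pair_eq u v (F : V -> V -> nat) :
  \sum_x \sum_y F x y * ((x == u) && (y == v)) = F u v.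
Proof.
rewrite (bigD1 u) //= [X in _ + X]big1 ?addn0; last first.
  by move=> x /negPf ->; apply: big1 => y _; rewrite muln0.
rewrite (bigD1 v) //= !eqxx muln1 big1 ?addn0 // => y /negPf ->.
by rewrite andbF muln0.
Qed.

Lemma edges2_edge u v Z : edges2 (edge u v) Z = 2 * ((u \in Z) && (v \in Z)).
Proof.
rewrite /edges2 /edge; under eq_bigr => x _ do under eq_bigr => y _ do rewrite mulnDr.
under eq_bigr => x _ do rewrite big_split /=; rewrite big_split /=.
by rewrite !(sum_pair_eq _ _ (fun x y => nat_of_bool ((x \in Z) && (y \in Z)))) mul2n -addnn;
  congr (_ + nat_of_bool _); rewrite andbC.
Qed.

(** The ordered pairs are split by the rank of their ends. Parity gives every nonempty set that is
    not tight in a sparse graph a slack of at least 2, which is room for one more edge. *)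
Lemma edges2_even H Z : multigraph H -> ~~ odd (edges2 H Z).
Proof.
case=> Hs H0; pose r (x y : V) := enum_rank x < enum_rank y.
have -> : edges2 H Z = \sum_x \sum_y r x y * (((x \in Z) && (y \in Z)) * H x y) +
    \sum_x \sum_y r y x * (((x \in Z) && (y \in Z)) * H x y).
  rewrite -big_split; apply: eq_bigr => x _; rewrite -big_split; apply: eq_bigr => y _ /=.
  rewrite -mulnDl /r; case: ltngtP => [||/val_inj/enum_rank_inj ->];
    rewrite ?addn0 ?add0n ?mul1n //.
  by rewrite H0 !muln0.
rewrite [X in _ + X]exchange_big /=.
under [X in _ + X]eq_bigr => x _ do under eq_bigr => y _ do rewrite andbC Hs.
by rewrite addnn odd_double.
Qed.

Lemma edges2_supermodular H A B :
  edges2 H A + edges2 H B <= edges2 H (A :|: B) + edges2 H (A :&: B).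
Proof.
rewrite /edges2 -!big_split; apply: leq_sum => x _; rewrite -!big_split.
apply: leq_sum => y _ /=; rewrite -!mulnDl leq_mul2r; apply/orP; right.
by rewrite !inE; case: (x \in A); case: (x \in B); case: (y \in A); case: (y \in B).
Qed.

Lemma leq_edges2 H K Z :
  (forall x y, x \in Z -> y \in Z -> H x y <= K x y) -> edges2 H Z <= edges2 K Z.
Proof.
move=> le; apply: leq_sum => x _; apply: leq_sum => y _.
case: (boolP (_ && _)) => // /andP[xZ yZ]; rewrite !mul1n; exact: le.
Qed.

Lemma eq_edges2 H K Z :
  (forall x y, x \in Z -> y \in Z -> H x y = K x y) -> edges2 H Z = edges2 K Z.
Proof. by move=> e; apply/eqP; rewrite eqn_leq !leq_edges2 // => x y xZ yZ; rewrite e. Qed.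

Lemma edges2_set0 H : edges2 H set0 = 0.
Proof. by rewrite /edges2 big1 // => x _; rewrite big1 // => y _; rewrite inE. Qed.

Lemma tight1 H x : H x x = 0 -> tight H [set x].
Proof.
move=> H0; rewrite /tight cards1 /edges2 big1 // => a _; rewrite big1 // => b _.
by rewrite !inE; case: eqP => [->|] //; case: eqP => [->|]; rewrite //= H0.
Qed.

(** Uncrossing: [edges2] is supermodular while cardinality is modular, so the sparsity bounds of
    union and intersection must both be attained. *)
Lemma tightUI H A B :
  sparse H -> tight H A -> tight H B -> A :&: B != set0 -> tight H (A :|: B) && tight H (A :&: B).
Proof.
move=> sH /eqP tA /eqP tB AB; have /set0Pn[x xAB] := AB.
have := sH _ AB; have : A :|: B != set0.
  by apply/set0Pn; exists x; move: xAB; rewrite !inE => /andP[->].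
move/sH; have := edges2_supermodular H A B; have := cardsUI A B.
rewrite /tight; lia.
Qed.

Lemma tightU H A B x :
  sparse H -> tight H A -> tight H B -> x \in A -> x \in B -> tight H (A :|: B).
Proof.
move=> sH tA tB xA xB; have AB : A :&: B != set0 by apply/set0Pn; exists x; rewrite inE xA.
by have /andP[] := tightUI sH tA tB AB.
Qed.

Lemma edges2_agree X Z H K :
  agree_off X H K -> X \subset Z -> edges2 K Z + edges2 H X = edges2 H Z + edges2 K X.
Proof.
move=> ag XZ.
pose rest L := \sum_x \sum_y [&& x \in Z, y \in Z & ~~ ((x \in X) && (y \in X))] * L x y.
have splitE L : edges2 L Z = edges2 L X + rest L.
  rewrite /edges2 -big_split; apply: eq_bigr => x _; rewrite -big_split; apply: eq_bigr => y _ /=.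
  rewrite -mulnDl; have /implyP := subsetP XZ x; have /implyP := subsetP XZ y.
  by case: (x \in X); case: (y \in X); case: (x \in Z); case: (y \in Z).
suff : rest K = rest H by rewrite !splitE; lia.
apply: eq_bigr => x _; apply: eq_bigr => y _.
case: (boolP (_ && _)) => [h|_]; rewrite ?mul0n // ag //.
by case/and3P: h.
Qed.

Definition patch X K H x y : nat := if (x \in X) && (y \in X) then K x y else H x y.

(** Uncross [Z] with [X]: the patched graph has as many edges as [H] on [Z :|: X], because both
    graphs are tight on [X], and it coincides with [K] on [Z :&: X]. *)
Lemma patch_sparse X H K :
  sparse H -> sparse K -> tight H X -> tight K X -> sparse (patch X K H).
Proof.
move=> sH sK tH tK Z Z0.
have ag : agree_off X H (patch X K H) by move=> x y /negPf xy; rewrite /patch xy.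
have eX : edges2 (patch X K H) X = edges2 K X.
  by apply: eq_edges2 => x y xX yX; rewrite /patch xX yX.
have eXH : edges2 (patch X K H) X = edges2 H X.
  by move: tH tK; rewrite eX /tight => /eqP hH /eqP; lia.
have [ZX|/set0Pn[x xZX]] := eqVneq (Z :&: X) set0.
  rewrite (@eq_edges2 _ H); first exact: sH.
  move=> x y xZ yZ; rewrite /patch; case: ifP => // /andP[xX _].
  by have := in_set0 x; rewrite -ZX inE xZ xX.
have := edges2_supermodular (patch X K H) Z X; have := edges2_agree ag (subsetUr Z X).
rewrite (@eq_edges2 (patch X K H) K (Z :&: X)); last first.
  by move=> a b; rewrite !inE => /andP[_ aX] /andP[_ bX]; rewrite /patch aX bX.
have : edges2 H (Z :|: X) + 4 <= 4 * #|Z :|: X|.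
  by apply: sH; apply/set0Pn; exists x; move: xZX; rewrite !inE => /andP[->].
have : edges2 K (Z :&: X) + 4 <= 4 * #|Z :&: X| by apply: sK; apply/set0Pn; exists x.
have := cardsUI Z X; move: tH tK => /eqP tH /eqP tK; lia.
Qed.

Lemma edges2_setC H S : (forall x y, H x y = H y x) ->
  edges2 H (~: S) + 2 * \sum_(x in S) deg H x = edges2 H setT + edges2 H S.
Proof.
move=> Hs; have -> : 2 * \sum_(x in S) deg H x =
    \sum_x \sum_y (x \in S) * H x y + \sum_x \sum_y (y \in S) * H x y.
  rewrite [X in _ = _ + X]exchange_big /= mul2n -addnn [X in X + _ = _]big_mkcond.
  rewrite [X in _ + X = _]big_mkcond /=; congr (_ + _); apply: eq_bigr => x _.
    by rewrite /deg -big_distrr; case: (x \in S); rewrite /= ?mul1n ?mul0n.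
  rewrite -big_distrr /deg; case: (x \in S); rewrite /= ?mul1n ?mul0n //.
  by apply: eq_bigr => y _; rewrite Hs.
rewrite /edges2 -!big_split; apply: eq_bigr => x _; rewrite -!big_split; apply: eq_bigr => y _ /=.
by rewrite -!mulnDl !inE; case: (x \in S); case: (y \in S).
Qed.

(** * The partition of the complement of [S] into maximal tight sets *)

Definition tight_class H S x : {set V} :=
  [arg max_(Z > [set x] | [&& tight H Z, [disjoint Z & S] & x \in Z]) #|Z|].

Section Classes.
Variables (H : V -> V -> nat) (S : {set V}).
Hypotheses (Hmg : multigraph H) (Hsp : sparse H).

(** The default [[set x]] is admissible, and tight sets sharing [x] have a tight union, so a set of
    maximum size contains all the others. *)
Lemma tight_classP x : x \notin S ->
  [/\ tight H (tight_class H S x), [disjoint tight_class H S x & S], x \in tight_class H S x &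
   forall Z, tight H Z -> [disjoint Z & S] -> x \in Z -> Z \subset tight_class H S x].
Proof.
move=> xS; rewrite /tight_class; case: arg_maxnP => [|W /and3P[tW WS xW] max].
  by rewrite tight1 ?Hmg.2 // disjoints1 xS inE eqxx.
split=> // Z tZ ZS xZ; have : [&& tight H (Z :|: W), [disjoint Z :|: W & S] & x \in Z :|: W].
  rewrite (tightU Hsp tZ tW xZ xW) !inE xZ /= andbT -setI_eq0 setIUl.
  by move: ZS WS; rewrite -!setI_eq0 => /eqP -> /eqP ->; rewrite setU0.
move/max => le; have : W == Z :|: W by rewrite eqEcard subsetUr.
by move/eqP ->; apply: subsetUl.
Qed.

Lemma tight_class_eq x y : x \notin S -> y \in tight_class H S x ->
  tight_class H S y = tight_class H S x.
Proof.
move=> xS yx; have [tx xD xx xmax] := tight_classP xS.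
have yS : y \notin S by rewrite (disjointFr xD yx).
have [ty yD yy ymax] := tight_classP yS.
have sxy := ymax _ tx xD yx; apply/eqP; rewrite eqEsubset sxy andbT.
by apply: xmax => //; apply: (subsetP sxy).
Qed.

(** Each class [Z] is tight and contributes 4|Z| - 4; the remaining pairs are cross pairs. *)
Lemma edges2_tight_classes :
  edges2 H (~: S) + 4 * #|[set tight_class H S x | x in ~: S]| =
    cross H (tight_class H S) S + 4 * #|~: S|.
Proof.
set c := tight_class H S; set P := c @: _.
have memP Z : Z \in P -> tight H Z /\ (forall x, (x \in Z) = (x \notin S) && (c x == Z)).
  case/imsetP => x; rewrite inE => xS ->; have [t D xx max] := tight_classP xS.
  split=> // y; apply/idP/andP => [yx|[yS /eqP <-]].
    by rewrite (disjointFr D yx) /c (tight_class_eq xS yx).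
  by have [] := tight_classP yS.
have -> : edges2 H (~: S) = cross H c S + \sum_(Z in P) edges2 H Z.
  have -> : \sum_(Z in P) edges2 H Z =
     \sum_x \sum_y [&& x \notin S, y \notin S & c x == c y] * H x y.
    rewrite /edges2 exchange_big /=; apply: eq_bigr => x _.
    rewrite exchange_big /=; apply: eq_bigr => y _.
    rewrite -big_distrl /=; congr (_ * _).
    case: (boolP (x \in S)) => xS.
      by apply: big1 => Z /memP[_ ->]; rewrite xS.
    have cP : c x \in P by rewrite imset_f // inE.
    rewrite (bigD1 (c x)) //= big1 ?addn0.
      by rewrite !(memP _ cP).2 xS eqxx /= [c y == _]eq_sym.
    by move=> Z /andP[/memP[_ ->] ne]; rewrite [c x == Z]eq_sym (negPf ne) andbF.
  rewrite /cross /edges2 -big_split; apply: eq_bigr => x _; rewrite -big_split.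
  apply: eq_bigr => y _ /=; rewrite -mulnDl !inE.
  by case: (x \in S); case: (y \in S); case: (c x == c y).
rewrite -addnA; congr (_ + _).
have -> : 4 * #|P| = \sum_(Z in P) 4 by rewrite sum_nat_const mulnC.
rewrite -big_split /= (eq_bigr (fun Z => 4 * #|Z|)); last by move=> Z /memP[/eqP].
rewrite -big_distrr /=; congr (_ * _).
rewrite -[RHS]sum1_card (partition_big c (mem P)) /=; last by move=> x xS; apply: imset_f.
apply: eq_bigr => Z /memP[_ mem]; rewrite -sum1_card; apply: eq_bigl => x.
by rewrite mem inE.
Qed.

End Classes.

(** * Edges outside [H] whose ends share no tight set *)

Section BlockedEdge.
Variables (m H : V -> V -> nat) (S : {set V}).
Hypotheses (mmg : multigraph m) (Hmg : multigraph H) (Hsp : sparse H).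
Hypothesis Hm : forall x y, H x y <= m x y.
Hypothesis tough : forall A : {set V}, 3 * iso m A + 2 * omega m A <= #|A| + 2.

(** Otherwise every edge of [m] missing from [H] lies inside a tight class, so [H] and [m] have the
    same cross edges for the partition into tight classes. Then [tough_partition] and
    [edges2_tight_classes] contradict the assumed bound. *)
Lemma blocked_edge :
  edges2 H (~: S) + 2 * #|S| + 4 < 4 * #|~: S| ->
  exists u v, [/\ u \notin S, v \notin S, H u v < m u v &
    forall Z, tight H Z -> [disjoint Z & S] -> u \in Z -> v \in Z -> False].
Proof.
move=> lt; pose good u v :=
  [exists Z : {set V}, [&& tight H Z, [disjoint Z & S], u \in Z & v \in Z]].
case: (pickP [pred p : V * V | [&& p.1 \notin S, p.2 \notin S,
  H p.1 p.2 < m p.1 p.2 & ~~ good p.1 p.2]]).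
  case=> [u v] /and4P[/= uS vS uv /existsPn bad]; exists u, v; split=> // Z tZ ZS uZ vZ.
  by have := bad Z; rewrite tZ ZS uZ vZ.
move=> none; have e : cross H (tight_class H S) S = cross m (tight_class H S) S; last first.
  have := edges2_tight_classes S Hmg Hsp.
  have : 4 * #|[set tight_class H S x | x in ~: S]|
      <= cross H (tight_class H S) S + 2 * #|S| + 4.
    by rewrite e; exact: tough_partition.
  lia.
apply: eq_bigr => x _; apply: eq_bigr => y _.
case: (boolP (_ && _)) => // /and3P[xS yS ne]; congr (_ * _); apply/eqP.
rewrite eqn_leq Hm /= leqNgt; apply: contra ne => ltxy.
have := none (x, y); rewrite /= xS yS ltxy /= => /negbFE/existsP[Z /and4P[tZ ZS xZ yZ]].
have [_ _ _ max] := tight_classP Hmg Hsp xS.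
by rewrite (tight_class_eq Hmg Hsp xS) // (subsetP (max Z tZ ZS xZ)).
Qed.

End BlockedEdge.

(** * Exchanging one edge for another *)

Definition swap H u v w z x y : nat := H x y + edge u v x y - edge w z x y.

Section Swap.
Variables (H : V -> V -> nat) (u v w z : V).
Hypotheses (Hmg : multigraph H) (uv : u != v) (wz : w != z) (Hwz : 0 < H w z).

(** The truncated subtraction in [swap] is exact because [w z] is an edge of [H]; counts of edges
    and degrees follow by additivity. *)
Lemma swapK x y : swap H u v w z x y + edge w z x y = H x y + edge u v x y.
Proof.
rewrite subnK //; apply: leq_trans (leq_addr _ _).
rewrite /edge; have [->|] := eqVneq x w; rewrite ?(negPf wz) /= ?addn0.
  by case: eqP => // ->.
by move=> _; case: eqP => [->|] //=; case: eqP => [->|] //=; rewrite Hmg.1.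
Qed.

Lemma edges2_swap Z :
  edges2 (swap H u v w z) Z + 2 * ((w \in Z) && (z \in Z)) =
  edges2 H Z + 2 * ((u \in Z) && (v \in Z)).
Proof.
by rewrite -!edges2_edge -!edges2D; apply: eq_edges2 => x y _ _; apply: swapK.
Qed.

Lemma deg_swap x :
  deg (swap H u v w z) x + ((x == w) + (x == z)) = deg H x + ((x == u) + (x == v)).
Proof. by rewrite -!deg_edge -!degD; apply: eq_bigr => y _; apply: swapK. Qed.

Lemma swap_multigraph : multigraph (swap H u v w z).
Proof.
split=> [x y|x]; first by rewrite /swap Hmg.1 edge_sym [edge w z x y]edge_sym.
by rewrite /swap Hmg.2 edgexx.
Qed.

(** Only a tight set containing [u] and [v] could become too dense, and it loses [w z]. Any other
    nonempty set contains at most one of [u], [v] or has slack 2 by parity. *)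
Lemma sparse_swap : sparse H ->
  (forall Z, tight H Z -> u \in Z -> v \in Z -> (w \in Z) && (z \in Z)) ->
  sparse (swap H u v w z).
Proof.
move=> Hsp hQ Z Z0; have := edges2_swap Z; have := Hsp Z Z0.
case: (boolP (tight H Z)) => tZ.
  have := hQ Z tZ; case: (u \in Z); case: (v \in Z) => //=; last by lia.
  - by move=> /(_ isT isT) ->; lia.
  - by lia.
  - by lia.
have := edges2_even Z Hmg; move: tZ; rewrite /tight.
case: (_ && _); case: (_ && _) => /=; lia.
Qed.

End Swap.

Lemma sparse_add H u v : multigraph H -> u != v -> sparse H ->
  (forall Z, tight H Z -> u \in Z -> v \in Z -> False) ->
  sparse (fun x y => H x y + edge u v x y).
Proof.
move=> Hmg uv Hsp nt Z Z0; rewrite edges2D edges2_edge.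
have := Hsp Z Z0; have := edges2_even Z Hmg.
case: (boolP (tight H Z)) => tZ.
  case: (boolP (u \in Z)) => uZ; case: (boolP (v \in Z)) => vZ /=; try lia.
  by case: (nt Z tZ uZ vZ).
by move: tZ; rewrite /tight; case: (_ && _) => /=; lia.
Qed.

Lemma multigraph_add H u v : multigraph H -> u != v ->
  multigraph (fun x y => H x y + edge u v x y).
Proof.
by case=> Hs H0 uv; split=> [x y|x]; rewrite ?H0 ?edgexx // Hs edge_sym.
Qed.

End SparseGraphs.

(** * Bases of small maximum degree *)

Section BoundedBases.
Variables (V : finType) (m : V -> V -> nat).
Implicit Types (H K : V -> V -> nat) (S X Z : {set V}).
Hypothesis mmg : multigraph m.
Hypothesis tough : forall A : {set V}, 3 * iso m A + 2 * omega m A <= #|A| + 2.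

(** By the Nash-Williams theorem these are exactly the unions of two edge-disjoint spanning trees of
    [m]. *)
Definition base H : Prop :=
  [/\ multigraph H, forall x y, H x y <= m x y, sparse H & tight H setT].

Lemma add_edge_le H u v : multigraph H -> (forall x y, H x y <= m x y) -> H u v < m u v ->
  forall x y, H x y + edge u v x y <= m x y.
Proof.
move=> Hmg Hm lt x y; have uv : u != v by apply: contraTneq lt => ->; rewrite mmg.2.
rewrite /edge; case: (boolP ((x == u) && (y == v))) => [/andP[/eqP -> /eqP ->]|_].
  by rewrite (negPf uv) addn1.
case: (boolP ((x == v) && (y == u))) => [/andP[/eqP -> /eqP ->]|_]; last by rewrite addn0.
by rewrite addn1 Hmg.1 mmg.1.
Qed.

(** Greedy growth: while the whole vertex set is not tight, [blocked_edge] with [S] empty gives an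
    edge lying in no tight set, which can be added. *)
Lemma base_exists : 0 < #|V| -> exists H, base H.
Proof.
move=> V0; have n0 : [set: V] != set0 by rewrite -card_gt0 cardsT.
suff ext H : multigraph H -> (forall x y, H x y <= m x y) -> sparse H -> exists K, base K.
  apply: (ext (fun _ _ => 0)) => // Z; rewrite -card_gt0 /edges2 big1; first by lia.
  by move=> x _; apply: big1 => y _; rewrite muln0.
have [n] := ubnP (4 * #|[set: V]| - edges2 H setT); elim: n H => // n IH H ltn Hmg Hm Hsp.
case: (boolP (tight H setT)) => [t|nt]; first by exists H.
have [|u [v [_ _ lt blocked]]] := blocked_edge (S := set0) mmg Hmg Hsp Hm tough.
  by move: nt; have := Hsp _ n0; rewrite /tight setC0 cards0; lia.
have uv : u != v by apply: contraTneq lt => ->; rewrite mmg.2.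
apply: (IH (fun x y => H x y + edge u v x y)).
- by rewrite edges2D edges2_edge !inE /=; have := Hsp _ n0; lia.
- exact: multigraph_add.
- exact: add_edge_le.
- apply: sparse_add => // Z tZ; apply: blocked => //.
  by rewrite -setI_eq0 setI0.
Qed.

(** * Lowering the maximum degree by local search *)

Section Lower.
Variable k : nat.
Hypothesis k5 : 5 <= k.

Definition top_degree H : {set V} := [set x | deg H x == k.+1].

(* [u] can be brought below degree [k] by rearranging [H] inside a tight set
   that avoids [S], without creating a vertex of degree [k + 1] there. *)
Definition relaxable H S u : Prop :=
  exists X K, [/\ u \in X, [disjoint X & S], tight H X, base K &
    [/\ agree_off X H K, deg K u < k & forall x, x \in X -> deg K x <= k]].

(** All bases have the same number of edges, and the two graphs have the same edges not inside
    [X]. *)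
Lemma base_agree_tight X H K : base H -> base K -> agree_off X H K -> tight H X -> tight K X.
Proof.
case=> _ _ _ /eqP tH [_ _ _ /eqP tK] ag /eqP tX; apply/eqP.
by have := edges2_agree ag (subsetT X); lia.
Qed.

Lemma patch_base X H K : base H -> base K -> tight H X -> tight K X -> base (patch X K H).
Proof.
move=> [Hmg Hm Hsp /eqP Ht] [Kmg Km Ksp _] /eqP HX /eqP KX; split.
- by split=> [x y|x]; rewrite /patch; [rewrite andbC Hmg.1 Kmg.1 | rewrite Hmg.2 Kmg.2 if_same].
- by move=> x y; rewrite /patch; case: ifP.
- by apply: patch_sparse => //; apply/eqP.
have ag : agree_off X H (patch X K H) by move=> x y /negPf xy; rewrite /patch xy.
have := edges2_agree ag (subsetT X).
have -> : edges2 (patch X K H) X = edges2 K X.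
  by apply: eq_edges2 => x y xX yX; rewrite /patch xX yX.
by move=> h; apply/eqP; lia.
Qed.

Lemma swap_base H u v w z : base H -> H u v < m u v -> w != z -> 0 < H w z ->
  (forall Z, tight H Z -> u \in Z -> v \in Z -> (w \in Z) && (z \in Z)) ->
  base (swap H u v w z).
Proof.
move=> [Hmg Hm Hsp /eqP Ht] lt wz Hwz hQ.
have uv : u != v by apply: contraTneq lt => ->; rewrite mmg.2.
split.
- exact: swap_multigraph.
- by move=> x y; apply: leq_trans (leq_subr _ _) _; apply: add_edge_le.
- exact: sparse_swap.
- by apply/eqP; have := edges2_swap u v Hmg wz Hwz setT; rewrite !inE /=; lia.
Qed.

(** If [w] had no neighbour in [Q], then [Q :\ w] would span as many edges as [Q] and violate
    sparsity. *)
Lemma tight_neighbour H Q u w : sparse H -> tight H Q -> u \in Q -> w \in Q -> u != w ->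
  exists2 z, z \in Q & 0 < H w z \/ 0 < H z w.
Proof.
move=> Hsp tQ uQ wQ uw.
case: (pickP [pred z | (z \in Q) && ((0 < H w z) || (0 < H z w))]) => [z /andP[zQ /orP h]|none].
  by exists z.
have : edges2 H Q = edges2 H (Q :\ w).
  apply: eq_bigr => x _; apply: eq_bigr => y _; rewrite !inE.
  case: (boolP (x \in Q)) => xQ; last by rewrite !andbF.
  case: (boolP (y \in Q)) => yQ; last by rewrite !andbF.
  have [->|_] := eqVneq x w.
    by have := none y; rewrite /= yQ /= => /negbT/norP[h _]; move: h;
      rewrite -eqn0Ngt => /eqP ->; rewrite !muln0.
  have [->|//] := eqVneq y w.
  by have := none x; rewrite /= xQ /= => /negbT/norP[_ h]; move: h;
      rewrite -eqn0Ngt => /eqP ->; rewrite !muln0.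
have : Q :\ w != set0 by apply/set0Pn; exists u; rewrite !inE uw.
move/Hsp; move: tQ => /eqP; rewrite (cardsD1 w Q) wQ; lia.
Qed.

(** This is where 5 comes from: the degree sum over [S], counted twice, is at least 10|S|. This
    covers 4|S| for the edges inside [S], 4|S| for passing from [V] to the complement of [S], and
    2|S| for the bound of [blocked_edge]. *)
Lemma high_degree_surplus H S : base H -> top_degree H \subset S -> top_degree H != set0 ->
  (forall x, x \in S -> k <= deg H x) ->
  edges2 H (~: S) + 2 * #|S| + 4 < 4 * #|~: S|.
Proof.
move=> [Hmg Hm Hsp /eqP Ht] DS D0 Sk.
have S0 : S != set0 by apply: contraNneq D0 => e; move: DS; rewrite e subset0.
have := edges2_setC S Hmg.1; have := Hsp S S0.
have := cardsC S; move: Ht; rewrite cardsT.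
have : k * #|S| + #|top_degree H| <= \sum_(x in S) deg H x.
  have -> : k * #|S| + #|top_degree H| = \sum_(x in S) (k + (x \in top_degree H)).
    rewrite big_split /= sum_nat_const mulnC; congr (_ + _).
    rewrite -sum1_card big_mkcond [RHS]big_mkcond; apply: eq_bigr => x _.
    by case: (boolP (x \in top_degree H)) => [/(subsetP DS) ->|_] //; case: ifP.
  apply: leq_sum => x xS; rewrite inE; case: eqP => [->|_]; first by rewrite addn1.
  by rewrite addn0; apply: Sk.
have := leq_mul k5 (leqnn #|S|); move: D0; rewrite -card_gt0; lia.
Qed.

(** Induction on |S|: an exchange either lowers a vertex of degree [k.+1], or shows that some
    vertices of [S] are relaxable, and these leave [S]. *)
Lemma lower_step H S : base H -> (forall x, deg H x <= k.+1) ->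
  top_degree H != set0 -> top_degree H \subset S -> (forall x, x \in S -> k <= deg H x) ->
  (forall x, x \notin S -> relaxable H S x) ->
  exists K, [/\ base K, forall x, deg K x <= k.+1 & #|top_degree K| < #|top_degree H|].
Proof.
move=> bH Hk D0; have [n] := ubnP #|S|; elim: n S => // n IH S ltn DS Sk relax.
have [Hmg Hm Hsp Ht] := bH.
have [u [v [uS vS lt blocked]]] :=
  blocked_edge mmg Hmg Hsp Hm tough (high_degree_surplus bH DS D0 Sk).
have [X [K [uX XS tX bK [agK Ku Kk]]]] := relax u uS.
have [Y [L [vY YS tY bL [agL Lv Lk]]]] := relax v vS.
(* If [X] and [Y] met, their union would be a tight set avoiding [S] and containing [u] and [v].
   Being disjoint, they can be rearranged independently. *)
have XY x : x \in X -> x \notin Y.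
  move=> xX; apply/negP => xY; apply: (blocked (X :|: Y)); rewrite ?inE ?uX ?vY ?orbT //.
    exact: (tightU Hsp tX tY xX xY).
  by rewrite -setI_eq0 setIUl; move: XS YS; rewrite -!setI_eq0 => /eqP -> /eqP ->; rewrite setU0.
have vX : v \notin X by apply: contraL vY; apply: XY.
have uY := XY _ uX.
have tKX := base_agree_tight bH bK agK tX.
have tLY := base_agree_tight bH bL agL tY.
have KY : edges2 K Y = edges2 H Y.
  apply: eq_edges2 => x y xY yY; apply: agK; rewrite negb_and.
  by apply/orP; left; apply: contraL xY; apply: XY.
have tKY : tight K Y by rewrite /tight KY.
(* [G] performs both rearrangements, so [u] and [v] have degree below [k] and can take one more
   edge. *)
pose G := patch Y L K; have bG : base G by apply: patch_base.
have [Gmg Gm Gsp Gt] := bG.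
have GoffY x y : x \notin Y -> G x y = K x y by move=> /negPf xY; rewrite /G /patch xY.
have GoffXY x y : x \notin X -> x \notin Y -> G x y = H x y.
  by move=> xX xY; rewrite GoffY // agK // negb_and xX.
have GX x : x \in X -> deg G x = deg K x.
  by move=> xX; apply: eq_bigr => y _; rewrite GoffY // XY.
have GY x : x \in Y -> deg G x = deg L x.
  move=> xY; apply: eq_bigr => y _; rewrite /G /patch xY /=; case: ifP => // /negbT yY.
  rewrite agL ?xY // agK // negb_and; apply/orP; left.
  by apply: contraL xY; apply: XY.
have agG (W : {set V}) : X \subset W -> Y \subset W -> agree_off W H G.
  move=> XW YW x y; rewrite negb_and => /orP h; rewrite /G /patch.
  have -> : (x \in Y) && (y \in Y) = false.
    by apply/negbTE; rewrite negb_and; apply/orP; case: h => [h|h]; [left|right];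
      apply: contra h; apply: (subsetP YW).
  apply: agK; rewrite negb_and; apply/orP; case: h => [h|h]; [left|right];
      by apply: contra h; apply: (subsetP XW).
pose inQ Q := [&& tight G Q, u \in Q & v \in Q].
have inT : inQ setT by rewrite /inQ Gt !inE.
(* By uncrossing, the smallest tight set [Q] lies in every tight set containing [u] and [v]. Hence
   any edge inside [Q] may be exchanged for [u v]. *)
case: (arg_minnP (fun Q : {set V} => #|Q|) inT) => Q /and3P[tQ uQ vQ] Qmin.
have QZ Z : tight G Z -> u \in Z -> v \in Z -> Q \subset Z.
  move=> tZ uZ vZ; have QZ0 : Q :&: Z != set0 by apply/set0Pn; exists u; rewrite inE uQ.
  have /andP[_ tQZ] := tightUI Gsp tQ tZ QZ0.
  have /Qmin le : inQ (Q :&: Z) by rewrite /inQ tQZ !inE uQ vQ uZ vZ.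
  have /eqP <- : Q :&: Z == Q by rewrite eqEcard subsetIl.
  exact: subsetIr.
pose W := Q :|: X :|: Y.
have XW : X \subset W by rewrite /W -setUA subsetU // subsetUl orbT.
have YW : Y \subset W by apply: subsetUr.
have tGX : tight G X.
  by rewrite /tight (@eq_edges2 _ G K) // => x y xX _; rewrite GoffY // XY.
have tGY : tight G Y.
  by rewrite /tight (@eq_edges2 _ G L) // => x y xY yY; rewrite /G /patch xY yY.
have tGW : tight G W.
  have tQX : tight G (Q :|: X) by apply: (tightU Gsp tQ tGX uQ uX).
  have vQX : v \in Q :|: X by rewrite inE vQ.
  exact: (tightU Gsp tQX tGY vQX vY).
have tW : tight H W.
  by apply: (base_agree_tight bG bH _ tGW) => x y xy; rewrite (agG W).
(* [W] is tight in [H] as well and contains the blocked pair, so it meets [S]; since [X] and [Y]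
   avoid [S], the meeting point is in [Q]. *)
have [w wQ wS] : exists2 w, w \in Q & w \in S.
  case: (pickP [pred w | (w \in W) && (w \in S)]) => [w /andP[/= wW wS]|none].
    exists w => //; move: wW; rewrite !inE => /orP[/orP[//|]|].
      by rewrite (disjointFl XS wS).
    by rewrite (disjointFl YS wS).
  case: (blocked W) => //; rewrite ?inE ?uQ ?vQ //.
  by rewrite -setI_eq0; apply/eqP/setP => x; rewrite !(inE, in_setI) -in_setU;
    have := none x; rewrite /= !inE.
(* Exchange [u v] for an edge of [G] at [x] inside [Q]. Only [u] and [v] can gain a degree compared
   with [G], and both have room for it. *)
have exch x : x \in Q -> x \in S -> exists F, [/\ base F, agree_off W H F, deg F x < deg H x,
    forall y, (y \in X) || (y \in Y) -> deg F y <= k &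
    forall y, y \notin X -> y \notin Y -> deg F y <= deg H y].
  move=> xQ xS.
  have xX : x \notin X by rewrite (disjointFl XS xS).
  have xY : x \notin Y by rewrite (disjointFl YS xS).
  have ux : u != x by apply: contraNneq xX => <-.
  have vx : v != x by apply: contraNneq xY => <-.
  have [z zQ xz] : exists2 z, z \in Q & 0 < G x z.
    have [z zQ h] := tight_neighbour Gsp tQ uQ xQ ux; exists z => //.
    by case: h; rewrite // Gmg.1.
  have xnz : x != z by apply: contraTneq xz => ->; rewrite Gmg.2.
  have Guv : G u v < m u v by rewrite GoffY // agK // negb_and vX orbT.
  have uv : u != v by apply: contraTneq lt => ->; rewrite mmg.2.
  exists (swap G u v x z); have dF := deg_swap u v Gmg xnz xz; split.
  - apply: swap_base => // Z tZ uZ vZ.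
    by rewrite !(subsetP (QZ Z tZ uZ vZ)).
  - move=> a b ab; have := swapK u v Gmg xnz xz a b.
    have eW c d : c \in Q -> d \in Q -> edge c d a b = 0.
      move=> cQ dQ; rewrite /edge; case: (boolP (_ && _)) => [/andP[/eqP ea /eqP eb]|_].
        by move: ab; rewrite ea eb !inE cQ dQ.
      by case: (boolP (_ && _)) => [/andP[/eqP ea /eqP eb]|//]; move: ab; rewrite ea eb !inE cQ dQ.
    by rewrite !eW // !addn0 (agG W).
  - have := dF x; rewrite eqxx ![x == _]eq_sym (negPf ux) (negPf vx) /=.
    have -> : deg G x = deg H x by apply: eq_bigr => y _; apply: GoffXY.
    by clear; lia.
  - move=> y yXY; have := dF y; have [eu|yu] := eqVneq y u.
      by rewrite eu (negPf uv) GX //=; move: Ku; clear; lia.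
    have [ev|yv] := eqVneq y v; first by rewrite ev GY //=; move: Lv; clear; lia.
    have : deg G y <= k by case/orP: yXY => h; [rewrite GX // Kk | rewrite GY // Lk].
    by rewrite /=; clear; lia.
  move=> y yX yY; have := dF y; have -> : deg G y = deg H y by apply: eq_bigr => a _; apply: GoffXY.
  have -> : (y == u) = false by apply: contraNF yX => /eqP ->.
  have -> : (y == v) = false by apply: contraNF yY => /eqP ->.
  by rewrite /=; clear; lia.
(* If [Q] contains a vertex of degree [k.+1], exchanging at it removes it from the top degree set
   and adds nobody. *)
case: (pickP [pred x | (x \in Q) && (x \in top_degree H)]) => [d /andP[/= dQ dD]|noD].
  have dS := subsetP DS _ dD; have [F [bF _ Fd FXY Foff]] := exch d dQ dS.
  have Fle y : deg F y <= k \/ deg F y <= deg H y.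
    case: (boolP ((y \in X) || (y \in Y))) => [h|]; first by left; apply: FXY.
    by rewrite negb_or => /andP[yX yY]; right; apply: Foff.
  exists F; split=> //.
    by move=> y; have := Hk y; case: (Fle y); clear; lia.
  have sub : top_degree F \subset top_degree H :\ d.
    apply/subsetP => y; rewrite !inE => /eqP Fy; apply/andP; split.
      by apply: contraTneq Fd => <-; have := Hk y; rewrite Fy; clear; lia.
    by have := Hk y; case: (Fle y); rewrite Fy; clear; lia.
  by apply: leq_ltn_trans (subset_leq_card sub) _; rewrite [X in _ < X](cardsD1 d) dD.
(* All of [Q] has degree at most [k] in [H], so an exchange brings any chosen vertex of [Q :&: S]
   below [k]; [W] witnesses that it is relaxable with respect to [S :\: Q]. *)
apply: (IH (S :\: Q)).
- apply: leq_trans (_ : #|S| <= _) => //; apply: proper_card; apply/properP; split.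
    exact: subsetDl.
  by exists w; rewrite // !inE wQ.
- apply/subsetP => x xD; rewrite inE (subsetP DS) // andbT.
  by have := noD x; rewrite /= xD andbT => ->.
- by move=> x; rewrite inE => /andP[_]; apply: Sk.
move=> x; rewrite inE negb_and negbK; case: (boolP (x \in S)) => xS; last first.
  move=> _; have [X' [K' [xX' X'S tX' bK' h]]] := relax x xS.
  by exists X', K'; split=> //; apply: disjointWr X'S; apply: subsetDl.
rewrite orbF => xQ; have [F [bF agF Fd FXY Foff]] := exch x xQ xS.
have Hk' y : y \in Q -> deg H y <= k.
  by move=> yQ; have := noD y; have := Hk y; rewrite /= yQ inE /=; clear; lia.
exists W, F; split=> //; first by rewrite !inE xQ.
  rewrite -setI_eq0; apply/eqP/setP => y; rewrite !inE.
  case: (boolP (y \in S)) => yS; last by rewrite !andbF.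
  by rewrite (disjointFl XS yS) (disjointFl YS yS) !orbF andbT andbN.
split=> //; first by apply: leq_trans Fd _; apply: Hk'.
move=> y; case: (boolP ((y \in X) || (y \in Y))) => [h _|]; first exact: FXY.
rewrite negb_or => /andP[yX yY]; rewrite !inE (negPf yX) (negPf yY) !orbF => yQ.
by apply: leq_trans (Foff y yX yY) _; apply: Hk'.
Qed.

Lemma lower_max_degree H : base H -> (forall x, deg H x <= k.+1) ->
  exists2 K, base K & forall x, deg K x <= k.
Proof.
have [n] := ubnP #|top_degree H|; elim: n H => // n IH H ltn bH Hk.
have [D0|D0] := eqVneq (top_degree H) set0.
  exists H => // x; have := Hk x; rewrite leq_eqVlt => /predU1P[e|//].
  by have := in_set0 x; rewrite -D0 inE e eqxx.
have [Hmg _ _ _] := bH.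
(* Initially every vertex outside [S] has degree below [k] and is relaxable through its own
   singleton, with [H] unchanged. *)
have [|x|x|K [bK Kk ltK]] := @lower_step H [set x | k <= deg H x] bH Hk D0.
- by apply/subsetP => x; rewrite !inE => /eqP ->.
- by rewrite inE.
- rewrite inE -ltnNge => xk; exists [set x], H; split.
  + by rewrite inE.
  + by rewrite disjoints1 inE -ltnNge.
  + by apply: tight1; apply: Hmg.2.
  + exact: bH.
  + by split=> // y; rewrite inE => /eqP ->; apply: ltnW.
- by apply: (IH K) => //; apply: leq_trans ltK _.
Qed.

End Lower.

Lemma base_max_degree5 : 0 < #|V| -> exists2 H, base H & forall x, deg H x <= 5.
Proof.
move=> V0; have [H bH] := base_exists V0.
have [n nH] : exists n, forall x, deg H x <= n + 5.
  by exists (\max_x deg H x) => x; apply: leq_trans (leq_bigmax x) _; apply: leq_addr.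
elim: n H bH nH => [|n IH] H bH nH; first by exists H.
have [K bK Kn] := lower_max_degree (leq_addl n 5) bH nH.
exact: IH bK Kn.
Qed.

End BoundedBases.

(** * Henneberg induction: two edge-disjoint connected spanning subgraphs *)

Section TwoConnected.
Variable V : finType.
Implicit Types (H T : V -> V -> nat) (U Z : {set V}).

Definition spans T U : Prop :=
  forall x y, x \in U -> y \in U -> connect (fun a b => 0 < T a b) x y.

(** The induction deletes vertices from [U] while the type [V] stays fixed, so deleted vertices
    remain as isolated ones. *)
Definition supported H U : Prop := forall x y, 0 < H x y -> (x \in U) && (y \in U).

Definition delete H (v x y : V) : nat := if (x == v) || (y == v) then 0 else H x y.

Lemma spans_sym_root T U r : (forall x y, T x y = T y x) ->
  (forall x, x \in U -> connect (fun a b => 0 < T a b) x r) -> spans T U.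
Proof.
move=> Ts h x y xU yU; apply: connect_trans (h x xU) _.
rewrite (@sym_connect_sym _ (fun a b => 0 < T a b)) ?h // => a b.
by rewrite Ts.
Qed.

Lemma spans_add_leaf T U p v : (forall x y, T x y = T y x) -> spans T U -> p \in U ->
  spans (fun x y => T x y + edge v p x y) (v |: U).
Proof.
move=> Ts sp pU; apply: (@spans_sym_root _ _ p) => [x y|x]; first by rewrite Ts edge_sym.
rewrite in_setU1 => /predU1P[->|xU].
  by apply: connect1; rewrite /edge !eqxx addn_gt0 orbT.
apply: connect_sub (sp x p xU pU) => a b ab; apply: connect1.
by rewrite addn_gt0 ab.
Qed.

(** Every passage along [p q] is rerouted through [v]. *)
Lemma spans_subdivide T U p q v : (forall x y, T x y = T y x) -> spans T U -> p \in U -> q \in U ->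
  spans (fun x y => T x y - edge p q x y + (edge v p x y + edge v q x y)) (v |: U).
Proof.
move=> Ts sp pU qU; set T' := fun x y => _.
have Ts' x y : T' x y = T' y x.
  by rewrite /T' Ts (edge_sym p q) (edge_sym v p) (edge_sym v q).
have T'v x : (x == p) || (x == q) -> 0 < T' v x.
  by rewrite /T' /edge eqxx; case/orP=> ->; rewrite !addn_gt0 ?orbT.
apply: (@spans_sym_root _ _ p Ts') => x; rewrite in_setU1 => /predU1P[->|xU].
  by apply: connect1; rewrite T'v ?eqxx.
apply: connect_sub (sp x p xU pU) => a b ab.
case: (boolP (0 < edge p q a b)) => e; last first.
  by apply: connect1; rewrite /T' -eqn0Ngt in e *; rewrite (eqP e) subn0 addn_gt0 ab.
have [ha hb] : ((a == p) || (a == q)) /\ ((b == p) || (b == q)).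
  by move: e; rewrite /edge addn_gt0 !lt0b => /orP[] /andP[-> ->]; rewrite ?orbT.
by apply: (@connect_trans _ _ v); apply: connect1; rewrite ?T'v // Ts' T'v.
Qed.

Lemma edges2_split_vertex H v Z : multigraph H -> v \in Z ->
  edges2 H Z = edges2 H (Z :\ v) + 2 * \sum_(y in Z) H v y.
Proof.
move=> [Hs H0] vZ.
have -> : 2 * \sum_(y in Z) H v y = \sum_x \sum_y (x == v) * ((y \in Z) * H x y) +
    \sum_x \sum_y (y == v) * ((x \in Z) * H x y).
  rewrite [X in _ = _ + X]exchange_big /= mul2n -addnn; congr (_ + _).
    rewrite [RHS](bigD1 v) //= eqxx [X in _ = _ + X]big1 ?addn0.
      by rewrite big_mkcond; apply: eq_bigr => y _; rewrite mul1n; case: (y \in Z); rewrite ?mul1n.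
    by move=> x /negPf ->; apply: big1 => y _; rewrite mul0n.
  rewrite [RHS](bigD1 v) //= eqxx [X in _ = _ + X]big1 ?addn0.
    by rewrite big_mkcond; apply: eq_bigr => y _; rewrite mul1n Hs; case: (y \in Z); rewrite ?mul1n.
  by move=> x /negPf ->; apply: big1 => y _; rewrite mul0n.
rewrite /edges2 -!big_split; apply: eq_bigr => x _; rewrite -!big_split; apply: eq_bigr => y _ /=.
rewrite !inE; have [->|_] := eqVneq x v; have [->|_] := eqVneq y v; rewrite ?H0 ?vZ /=.
- by rewrite !muln0.
- by case: (y \in Z); clear; lia.
- by case: (x \in Z); clear; lia.
by case: (x \in Z); case: (y \in Z); clear; lia.
Qed.

Lemma edges2_delete H v Z : edges2 (delete H v) Z = edges2 H (Z :\ v).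
Proof.
apply: eq_bigr => x _; apply: eq_bigr => y _; rewrite /delete !inE.
by case: (x == v); case: (y == v); rewrite //= ?andbF ?muln0.
Qed.

Lemma delete_multigraph H v : multigraph H -> multigraph (delete H v).
Proof. by case=> Hs H0; split=> [x y|x]; rewrite /delete ?H0 ?if_same // orbC Hs. Qed.

Lemma sparse_le H T : sparse H -> (forall x y, T x y <= H x y) -> sparse T.
Proof.
move=> sH le Z Z0; apply: leq_trans (sH Z Z0); rewrite leq_add2r.
by apply: leq_edges2.
Qed.

Lemma delete_le H v x y : delete H v x y <= H x y.
Proof. by rewrite /delete; case: ifP. Qed.

(** Used when [v] is put back: [row] collects the multiplicities of the edges at [v] given to the
    two subgraphs together. *)
Lemma delete_row H v (row : V -> nat) T : (forall x y, H x y = H y x) -> H v v = 0 ->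
  (forall x y, T x y <= delete H v x y) -> row v = 0 -> (forall y, row y <= H v y) ->
  forall x y, T x y + ((x == v) * row y + (y == v) * row x) <= H x y.
Proof.
move=> Hs H0 Tle rv rle x y; have := Tle x y; rewrite /delete.
have [->|xv] := eqVneq x v; have [->|yv] := eqVneq y v; rewrite /= ?leqn0.
- by move=> /eqP ->; rewrite rv !muln0.
- by move=> /eqP ->; rewrite add0n mul1n mul0n addn0.
- by move=> /eqP ->; rewrite add0n mul1n mul0n add0n Hs.
by rewrite !mul0n !addn0.
Qed.

(* Henneberg induction: a vertex of degree at most 3 is deleted and, when its
   degree is 3, two of its neighbours that lie in no common tight set are joined. *)
Lemma two_connected_subgraphs H U :
  U != set0 -> multigraph H -> sparse H -> tight H U -> supported H U ->
  exists T1 T2, [/\ forall x y, T1 x y = T1 y x, forall x y, T2 x y = T2 y x,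
    forall x y, T1 x y + T2 x y <= H x y, spans T1 U & spans T2 U].
Proof.
have [n] := ubnP #|U|; elim: n H U => // n IH H U ltn U0 Hmg Hsp tU sup.
have [Hs H0] := Hmg.
have [cU|cU] := leqP #|U| 1.
  have /cards1P[x eU] : #|U| == 1 by rewrite eqn_leq cU card_gt0.
  exists (fun _ _ => 0), (fun _ _ => 0); split=> // a b;
    by rewrite eU !inE => /eqP -> /eqP ->; apply: connect0.
have degU x : x \in U -> \sum_(y in U) H x y = deg H x.
  move=> xU; rewrite big_mkcond; apply: eq_bigr => y _; case: ifP => // /negbT yU.
  by apply/esym/eqP; rewrite eqn0Ngt; apply: contra yU => /sup/andP[].
(* The degrees in the tight set [U] sum to 4|U| - 4, so their average is below 4. *)
have [v vU dv] : exists2 v, v \in U & deg H v <= 3.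
  case: (pickP [pred v | (v \in U) && (deg H v <= 3)]) => [v /andP[vU dv]|none]; first by exists v.
  have : \sum_(x in U) 4 <= \sum_(x in U) deg H x.
    by apply: leq_sum => x xU; have := none x; rewrite /= xU /= leqNgt => /negbFE.
  have -> : \sum_(x in U) deg H x = edges2 H U.
    rewrite /edges2 big_mkcond; apply: eq_bigr => x _.
    case: (boolP (x \in U)) => xU; last by rewrite big1.
    rewrite -(degU x xU) big_mkcond; apply: eq_bigr => y _; by case: (y \in U); rewrite ?mul1n.
  by rewrite sum_nat_const; move: tU => /eqP; lia.
have cU' : #|U| = #|U :\ v|.+1 by rewrite (cardsD1 v U) vU.
have U'0 : U :\ v != set0 by rewrite -card_gt0; lia.
have eU : edges2 H U = edges2 H (U :\ v) + 2 * deg H v by rewrite (edges2_split_vertex Hmg vU) degU.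
have dv2 : 2 <= deg H v by have := Hsp _ U'0; move: tU => /eqP; lia.
have dmg := delete_multigraph v Hmg.
have dsp : sparse (delete H v) := sparse_le Hsp (delete_le H v).
(* With [r] counting the edges at [v] already chosen, this supplies another one, possibly parallel
   to them. *)
have nbr (r : V -> nat) : \sum_y r y < deg H v -> exists q, r q < H v q.
  move=> lt; case: (pickP [pred q | r q < H v q]) => [q rq|none]; first by exists q.
  suff h : deg H v <= \sum_y r y by move: lt; rewrite ltnNge h.
  by apply: leq_sum => y _; have := none y; rewrite /= ltnNge => /negbFE.
have nU q : 0 < H v q -> q \in U :\ v.
  move=> h; have /andP[_ qU] := sup _ _ h; rewrite !inE qU andbT.
  by apply: contraTneq h => ->; rewrite H0.
have eqU : v |: (U :\ v) = U by rewrite setD1K.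
have edgev q x y : q != v -> edge v q x y = (x == v) * (y == q) + (y == v) * (x == q).
  by move=> _; rewrite /edge -!mulnb [(x == q) * _]mulnC.
(* Attach [v] as a leaf to both subgraphs; the last premise asks for two parallel edges when [q]
   equals [p]. *)
have extend T1 T2 p q : (forall x y, T1 x y = T1 y x) -> (forall x y, T2 x y = T2 y x) ->
    (forall x y, T1 x y + T2 x y <= delete H v x y) -> spans T1 (U :\ v) -> spans T2 (U :\ v) ->
    0 < H v p -> (q == p) < H v q ->
    exists T1 T2, [/\ forall x y, T1 x y = T1 y x, forall x y, T2 x y = T2 y x,
    forall x y, T1 x y + T2 x y <= H x y, spans T1 U & spans T2 U].
  move=> s1 s2 le12 sp1 sp2 vp vq.
  have pU := nU p vp; have qU := nU q (leq_ltn_trans (leq0n _) vq).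
  have pv : p != v by move: pU; rewrite !inE => /andP[].
  have qv : q != v by move: qU; rewrite !inE => /andP[].
  exists (fun x y => T1 x y + edge v p x y), (fun x y => T2 x y + edge v q x y); split.
  - by move=> x y; rewrite s1 edge_sym.
  - by move=> x y; rewrite s2 edge_sym.
  - move=> x y; rewrite !edgev // addnACA [X in _ + X]addnACA -!mulnDr.
    apply: (delete_row (row := fun y => (y == p) + (y == q)) Hs (H0 v) le12) => [|z].
      by rewrite /= !(eq_sym v) (negPf pv) (negPf qv).
    have [->|zp] := eqVneq z p; have [e|zq] := eqVneq _ q => //=.
      by move: vq; rewrite -e eqxx.
    by rewrite e; move: vq; case: (q == p) => //; apply: ltnW.
  - by rewrite -eqU; apply: spans_add_leaf.
  - by rewrite -eqU; apply: spans_add_leaf.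
have supd : supported (delete H v) (U :\ v).
  move=> x y; rewrite /delete !inE; case: eqP => //= _; case: eqP => //= _; exact: sup.
have [p vp] : exists p, 0 < H v p.
  by apply: (nbr (fun _ => 0)); rewrite big1 //; lia.
have [dv3|dv3] := leqP (deg H v) 2.
  have [||T1 [T2 [s1 s2 le sp1 sp2]]] := IH (delete H v) (U :\ v) _ U'0 dmg dsp _ supd.
  - by move: ltn; rewrite cU'; clear; lia.
  - rewrite /tight edges2_delete (_ : (U :\ v) :\ v = U :\ v); last first.
      by apply/setP => x; rewrite !inE andbA andbb.
    by move: tU eU cU' dv2 dv3 => /eqP; clear; lia.
  have [q vq] : exists q, (q == p) < H v q by apply: nbr; rewrite sum_eq1.
  exact: (extend T1 T2 p q).
have pU := nU p vp; have pv : p \notin [set v] by move: pU; rewrite !inE => /andP[].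
have [tZ Zv pZ Zmax] := tight_classP Hmg Hsp pv.
set Z := tight_class H [set v] p in tZ Zv pZ Zmax.
have vZ : v \notin Z by rewrite disjoint_sym disjoints1 in Zv.
(* If all three edges at [v] ended in the tight set [Z], then [v |: Z] would exceed the sparsity
   bound by one edge. *)
have [q vq qZ] : exists2 q, 0 < H v q & q \notin Z.
  case: (pickP [pred q | (0 < H v q) && (q \notin Z)]) => [q /andP[vq qZ]|none]; first by exists q.
  have sZ : \sum_(y in v |: Z) H v y = deg H v.
    rewrite big_mkcond; apply: eq_bigr => y _; rewrite !inE.
    case: eqP => [->|_]; first by [].
    case: (boolP (y \in Z)) => //= yZ; have := none y; rewrite /= yZ andbT.
    by move/negbT; rewrite -eqn0Ngt => /eqP.
  have vZ0 : v |: Z != set0 by apply/set0Pn; exists v; rewrite !inE eqxx.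
  have := Hsp _ vZ0; rewrite (edges2_split_vertex Hmg (setU11 v Z)) sZ setU1K // cardsU1 vZ.
  by move: tZ dv3 => /eqP; clear; lia.
have qU := nU q vq.
have pq : p != q by apply: contraNneq qZ => <-.
have [r vr] : exists r, (r == p) + (r == q) < H v r.
  by apply: nbr; rewrite big_split /= !sum_eq1.
pose H' x y := delete H v x y + edge p q x y.
have H'mg : multigraph H' by apply: multigraph_add.
have dZ : (U :\ v) :\ v = U :\ v by apply/setP => x; rewrite !inE andbA andbb.
have H'sp : sparse H'.
  move=> X X0; rewrite /H' edges2D edges2_edge edges2_delete.
  case: (boolP (_ && _)) => [/andP[pX qX]|_]; last first.
    by have := dsp X X0; rewrite edges2_delete; clear; lia.
  have pX' : p \in X :\ v by move: pv; rewrite !inE => ->.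
  have nt : ~~ tight H (X :\ v).
    apply/negP => tX; have := Zmax _ tX _ pX'; rewrite disjoint_sym disjoints1 !inE eqxx.
    move=> /(_ isT)/subsetP/(_ q); rewrite (negPf qZ); move: qU; rewrite !inE => /andP[-> _].
    by move/(_ qX).
  have X'0 : X :\ v != set0 by apply/set0Pn; exists p.
  have := Hsp _ X'0; have := edges2_even (X :\ v) Hmg; move: nt; rewrite /tight.
  have := subset_leq_card (subsetDl X [set v]); rewrite /=; clear; lia.
have [||x y|T1 [T2 [s1 s2 le sp1 sp2]]] := IH H' (U :\ v) _ U'0 H'mg H'sp _ _.
- by move: ltn; rewrite cU'; clear; lia.
- rewrite /tight /H' edges2D edges2_edge edges2_delete dZ pU qU /=.
  by move: tU eU cU' dv2 dv3 dv => /eqP; clear; lia.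
- rewrite /H' addn_gt0 => /orP[/supd //|]; rewrite /edge addn_gt0 !lt0b.
  by case/orP=> /andP[/eqP -> /eqP ->]; rewrite pU qU.
have [lepq|ltpq] := leqP (T1 p q + T2 p q) (delete H v p q).
  apply: (extend T1 T2 p q) => //; last by rewrite eq_sym (negPf pq).
  move=> x y; have := le x y; rewrite /H' /edge.
  case: (boolP ((x == p) && (y == q))) => [/andP[/eqP -> /eqP ->] //|_].
  case: (boolP ((x == q) && (y == p))) => [/andP[/eqP -> /eqP ->] _|_]; last by rewrite !addn0.
  by rewrite s1 s2 dmg.1.
have subdiv T T' : (forall x y, T x y = T y x) -> (forall x y, T' x y = T' y x) ->
    (forall x y, T x y + T' x y <= H' x y) -> spans T (U :\ v) -> spans T' (U :\ v) ->
    0 < T p q -> exists T1 T2, [/\ forall x y, T1 x y = T1 y x, forall x y, T2 x y = T2 y x,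
    forall x y, T1 x y + T2 x y <= H x y, spans T1 U & spans T2 U].
  move=> s s' leT sp sp' Tpq; have rU := nU r (leq_ltn_trans (leq0n _) vr).
  have pv' : p != v by move: pv; rewrite inE.
  have qv : q != v by move: qU; rewrite !inE => /andP[].
  have rv : r != v by move: rU; rewrite !inE => /andP[].
  exists (fun x y => T x y - edge p q x y + (edge v p x y + edge v q x y)),
    (fun x y => T' x y + edge v r x y); split.
  - by move=> x y; rewrite s (edge_sym p q) (edge_sym v p) (edge_sym v q).
  - by move=> x y; rewrite s' edge_sym.
  - move=> x y; rewrite !edgev // addnACA [X in _ + (X + _)]addnACA.
    rewrite [X in _ + X]addnACA -!mulnDr.
    apply: (delete_row (row := fun y => (y == p) + (y == q) + (y == r))
             (T := fun x y => T x y - edge p q x y + T' x y) Hs (H0 v)) => [a b||z].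
    + have := leT a b; rewrite /H'.
      suff : edge p q a b <= T a b by clear; lia.
      rewrite /edge; case: (boolP ((a == p) && (b == q))) => [/andP[/eqP -> /eqP ->]|_].
        by rewrite (negPf pq).
      by case: (boolP ((a == q) && (b == p))) => [/andP[/eqP -> /eqP ->]|//]; rewrite s.
    + by rewrite /= !(eq_sym v) (negPf pv') (negPf qv) (negPf rv).
    have [->|zr] := eqVneq z r; first by rewrite /= addn1.
    rewrite /= addn0; have [->|zp] := eqVneq z p; first by rewrite (negPf pq).
    by case: eqP => [->|].
  - by rewrite -eqU; apply: spans_subdivide.
  - by rewrite -eqU; apply: spans_add_leaf.
have [T1pq|T1pq] := posnP (T1 p q).
  apply: (subdiv T2 T1) => //; first by move=> x y; rewrite addnC.
  by move: ltpq; rewrite T1pq; clear; lia.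
exact: (subdiv T1 T2).
Qed.

End TwoConnected.

(** * T-joins in connected graphs *)

Section TJoins.
Variables (V : finType) (g : rel V).
Hypotheses (gs : symmetric g) (gi : irreflexive g).

(** A T-join of the simple graph [g], where T is the set of vertices satisfying [P]. *)
Definition join (J : V -> V -> bool) (P : pred V) : Prop :=
  [/\ symmetric J, forall x y, J x y -> g x y & forall x, odd (\sum_y J x y) = P x].

Lemma odd_sum (F : V -> nat) : odd (\sum_y F y) = \big[addb/false]_y odd (F y).
Proof. by apply: (big_morph odd oddD). Qed.

Lemma join_addb J K P Q : join J P -> join K Q ->
  join (fun x y => J x y (+) K x y) (fun x => P x (+) Q x).
Proof.
move=> [Js Jg Jd] [Ks Kg Kd]; split=> [x y|x y|x]; first by rewrite Js Ks.
  by case: (boolP (J x y)) => [/Jg //|_] /=; apply: Kg.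
rewrite -Jd -Kd !odd_sum -big_split; apply: eq_bigr => y _ /=.
by case: (J x y); case: (K x y).
Qed.

Lemma join_eq J P Q : P =1 Q -> join J P -> join J Q.
Proof. by move=> e [Js Jg Jd]; split=> // x; rewrite Jd. Qed.

Lemma join_nil : join (fun _ _ => false) xpred0.
Proof. by split=> // x; rewrite big1. Qed.

Lemma join_edge x y : g x y -> exists J, join J (fun z => (z == x) (+) (z == y)).
Proof.
move=> xy; have ne : x != y by apply: contraTneq xy => ->; rewrite gi.
exists (fun a b => ((a == x) && (b == y)) || ((a == y) && (b == x))); split=> [a b|a b|a].
- by rewrite orbC; congr (_ || _); rewrite andbC.
- by case/orP=> /andP[/eqP -> /eqP ->]; rewrite // gs.
have [->|ax] := eqVneq a x; rewrite ?(negPf ne) /=.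
  by under eq_bigr do rewrite orbF; rewrite sum_eq1.
have [_|ay] := eqVneq a y; first by rewrite sum_eq1.
by rewrite big1.
Qed.

(** Take the symmetric difference of the edges along a walk; the inner vertices cancel. *)
Lemma join_connect x y : connect g x y -> exists J, join J (fun z => (z == x) (+) (z == y)).
Proof.
case/connectP=> p; elim: p x => [|z p IH] x /=.
  move=> _ ->; exists (fun _ _ => false); apply: join_eq join_nil => a /=.
  by rewrite addbb.
case/andP=> /join_edge[J JP] /IH h /h[K KP]; eexists; apply: join_eq (join_addb JP KP) => a /=.
by rewrite addbA -[X in X (+) _]addbA addbb addbF.
Qed.

(** Pair up the vertices of [T] and add the joins of the pairs modulo 2. *)
Lemma join_exists (T : {set V}) : (forall x y, connect g x y) -> ~~ odd #|T| ->
  exists J, join J (mem T).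
Proof.
move=> gc; have [n] := ubnP #|T|; elim: n T => // n IH T ltn ev.
have [->|/set0Pn[x xT]] := eqVneq T set0.
  by exists (fun _ _ => false); apply: join_eq join_nil => a; rewrite /= inE.
have [e|/set0Pn[y yT]] := eqVneq (T :\ x) set0.
  by move: ev; rewrite (cardsD1 x) xT e cards0.
have [J JP] := join_connect (gc x y).
have cT : #|T| = #|T :\ x :\ y|.+2 by rewrite (cardsD1 x) xT (cardsD1 y (T :\ x)) yT.
have [||K KP] := IH (T :\ x :\ y).
- by move: ltn; rewrite cT => /ltnW.
- by move: ev; rewrite cT /= negbK.
exists (fun a b => J a b (+) K a b); apply: join_eq (join_addb JP KP) => a /=.
move: yT; rewrite !inE => /andP[yx yT].
have [->|ax] := eqVneq a x; first by rewrite xT eq_sym (negPf yx).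
by have [->|ay] := eqVneq a y; rewrite ?yT.
Qed.

End TJoins.

(** * Parity correction and the connected factor *)

Lemma even_odd_degrees (V : finType) (H : V -> V -> nat) :
  multigraph H -> ~~ odd #|[set x | odd (deg H x)]|.
Proof.
move=> Hmg; have := edges2_even setT Hmg.
have -> : edges2 H setT = \sum_x deg H x.
  by apply: eq_bigr => x _; apply: eq_bigr => y _; rewrite !inE mul1n.
suff -> : odd (\sum_x deg H x) = odd #|[set x | odd (deg H x)]| by [].
rewrite -sum1_card [in RHS]big_mkcond /= [LHS]odd_sum [RHS]odd_sum.
by apply: eq_bigr => x _; rewrite !inE; case: (odd _).
Qed.

(** The join uses each adjacent pair of [T2] at most once, so adding it to [T1] stays below [H]. *)
Lemma even_connected_subgraph (V : finType) (H T1 T2 : V -> V -> nat) :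
  (forall x, H x x = 0) ->
  (forall x y, T1 x y = T1 y x) -> (forall x y, T2 x y = T2 y x) ->
  (forall x y, T1 x y + T2 x y <= H x y) -> connected_mg T1 -> connected_mg T2 ->
  exists f, [/\ multigraph f, forall x y, f x y <= H x y, forall x, ~~ odd (deg f x) &
    connected_mg f].
Proof.
move=> H0 s1 s2 le c1 c2.
have T1mg : multigraph T1.
  by split=> // x; apply/eqP; rewrite -leqn0 -(H0 x); apply: leq_trans (le x x); apply: leq_addr.
have T20 x : T2 x x = 0.
  by apply/eqP; rewrite -leqn0 -(H0 x); apply: leq_trans (le x x); apply: leq_addl.
have gs : symmetric (fun x y => 0 < T2 x y) by move=> x y; rewrite s2.
have gi : irreflexive (fun x y => 0 < T2 x y) by move=> x; rewrite T20.
have [J [Js Jg Jd]] := join_exists gs gi c2 (even_odd_degrees T1mg).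
exists (fun x y => T1 x y + J x y); split.
- split=> [x y|x]; first by rewrite s1 Js.
  by rewrite T1mg.2; case: (boolP (J x x)) => // /Jg; rewrite T20.
- move=> x y; apply: leq_trans (le x y); rewrite leq_add2l.
  by case: (boolP (J x y)) => // /Jg.
- by move=> x; rewrite degD oddD Jd /= inE addbb.
move=> x y; apply: connect_sub (c1 x y) => a b ab; apply: connect1.
by rewrite addn_gt0 ab.
Qed.

Lemma connected_deg_gt0 (V : finType) (f : V -> V -> nat) x y :
  connected_mg f -> x != y -> 0 < deg f x.
Proof.
move=> /(_ x y)/connectP[[|z p] /=]; first by move=> _ ->; rewrite eqxx.
by case/andP=> xz _ _ _; rewrite /deg (bigD1 z) //= addn_gt0 xz.
Qed.

(* Hypothesis (3/2) iso + omega <= (1/2)|S| + 1, multiplied by 2. *)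
Theorem mainTheorem18 (V : finType) (m : V -> V -> nat) :
  multigraph m ->
  (forall S : {set V}, 3 * iso m S + 2 * omega m S <= #|S| + 2) ->
  exists f : V -> V -> nat, is_factor m [:: 2; 4] f /\ connected_mg f.
Proof.
move=> mmg tough.
have [V0|V0] := posnP #|V|.
  exists m; split; last by move=> x; have := fintype0 x V0.
  by split; [split | move=> x; have := fintype0 x V0].
have [H [Hmg Hm Hsp Ht] H5] := base_max_degree5 mmg tough V0.
have TN0 : [set: V] != set0 by rewrite -card_gt0 cardsT.
have supT : supported H setT by move=> x y _; rewrite !inE.
have [T1 [T2 [s1 s2 le sp1 sp2]]] := two_connected_subgraphs TN0 Hmg Hsp Ht supT.
have c1 : connected_mg T1 by move=> x y; apply: sp1; rewrite inE.
have c2 : connected_mg T2 by move=> x y; apply: sp2; rewrite inE.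
have [f [fmg fH fev fc]] := even_connected_subgraph Hmg.2 s1 s2 le c1 c2.
exists f; split=> //; split.
  by split=> // x y; apply: leq_trans (Hm x y).
(* A second vertex is what makes the degree of [x] positive. A one-vertex graph violates the
   hypothesis for the empty set, since its vertex is isolated. *)
move=> x; have [y xy] : exists y, x != y.
  case: (pickP (fun y => x != y)) => [y xy|none]; first by exists y.
  have eqx y : y = x by have := none y; move/negbFE/eqP.
  have : 0 < iso m set0.
    rewrite card_gt0; apply/set0Pn; exists x; rewrite !inE /=.
    by apply/forallP => y; rewrite /adjD !inE (eqx y) mmg.2.
  by have := tough set0; rewrite cards0; clear; lia.
have d0 := connected_deg_gt0 fc xy.
have d5 : deg f x <= 5 by apply: leq_trans (H5 x); apply: leq_sum => z _; apply: fH.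
(* An even degree between 1 and 5 is 2 or 4. *)
by move: (fev x) d0 d5; case: (deg f x) => [|[|[|[|[|[|n]]]]]].
Qed.
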